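(* Let $\rho$ be a state on $S$, $C$ a finite-dimensional catalytic system with state $c$, and $\Lambda$ a covariant operation from $S\otimes C$ to $S'\otimes C$ such that $\mathrm{Tr}_{S'}[\Lambda(\rho\otimes c)]=c$. Let $\rho'=\mathrm{Tr}_C[\Lambda(\rho\otimes c)]$. Then $\mathcal{C}'(\rho')\subseteq\mathcal{C}'(\rho)$. Equivalently, if $\mathcal{C}'(\rho')\not\subseteq\mathcal{C}'(\rho)$, there is no correlated-catalytic covariant transformation from $\rho$ to $\rho'$.
   Context: All systems are finite-dimensional quantum systems $X$ with Hamiltonians $H_X$; composites carry the sum Hamiltonian. A channel $\Lambda:X\to Y$ is covariant if $\Lambda(e^{-iH_Xt}\sigma e^{iH_Xt})=e^{-iH_Yt}\Lambda(\sigma)e^{iH_Yt}$ for all states $\sigma$ and $t\in\mathbb{R}$. Writing $H_X=\sum_kE_k\Pi_k$ (distinct eigenvalues, spectral projectors), $\mathcal{D}(\sigma)=\{E_k-E_l:\Pi_k\sigma\Pi_l\ne0\}$, and the set of rational coherent modes $\mathcal{C}'(\sigma)$ is the set of all finite linear combinations with rational coefficients of elements of $\mathcal{D}(\sigma)$. *)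

(* Defs.v *)
(* MathComp + MathComp-Analysis (cos/sin on a realType R), complex
   numbers R[i] from mathcomp-real-closed, Kronecker product from mxtens. *)
From HB Require Import structures.
From mathcomp Require Import all_boot all_order all_algebra.
From mathcomp Require Import sesquilinear spectral.
From mathcomp Require Import complex mxtens.
From mathcomp Require Import reals trigo.

Set Implicit Arguments.
Unset Strict Implicit.
Unset Printing Implicit Defensive.

Import Order.TTheory GRing.Theory Num.Theory.
Local Open Scope ring_scope.

Section QDefs.
Variable R : realType.
Local Notation C := (R[i]).

(* conjugate transpose *)
Definition adjmx m n (A : 'M[C]_(m, n)) : 'M[C]_(n, m) := (A ^t*)%sesqui.
(* unitarity: the library's  V \is unitarymx  (spectral.v) *)

(* positive semidefinite (over C this implies Hermitian) *)
Definition psdmx n (A : 'M[C]_n) : Prop :=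
  forall v : 'cV[C]_n, 0 <= (adjmx v *m A *m v) 0 0.

(* density operator *)
Definition is_state n (A : 'M[C]_n) : Prop := psdmx A /\ \tr A = 1.

(* id_k (x) f, acting on 'M_(k * n) with the Kronecker index convention of mxtens *)
Definition ampliate k n m (f : 'M[C]_n -> 'M[C]_m) (A : 'M[C]_(k * n)) : 'M[C]_(k * m) :=
  \matrix_(i, j)
    f (\matrix_(p, q) A (mxtens_index ((mxtens_unindex i).1, p))
                        (mxtens_index ((mxtens_unindex j).1, q)))
      (mxtens_unindex i).2 (mxtens_unindex j).2.

(* quantum channel: linear, completely positive, trace preserving *)
Definition is_channel n m (f : 'M[C]_n -> 'M[C]_m) : Prop :=
  [/\ (forall (a : C) (A B : 'M[C]_n), f (a *: A + B) = a *: f A + f B),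
      (forall k (A : 'M[C]_(k * n)), psdmx A -> psdmx (@ampliate k n m f A)) &
      (forall A, \tr (f A) = \tr A)].

(* partial traces on X (x) Y  ('M_(p * q)) *)
Definition ptr_first p q (X : 'M[C]_(p * q)) : 'M[C]_q :=
  \matrix_(c, c') \sum_(s < p) X (mxtens_index (s, c)) (mxtens_index (s, c')).
Definition ptr_second p q (X : 'M[C]_(p * q)) : 'M[C]_p :=
  \matrix_(s, s') \sum_(c < q) X (mxtens_index (s, c)) (mxtens_index (s', c)).

(* A Hamiltonian on C^n is given by its diagonalisation H = V diag(h) V^†,
   with V unitary and h : 'I_n -> R (every Hermitian matrix is of this form). *)
Definition hamiltonian n (V : 'M[C]_n) (h : 'I_n -> R) : 'M[C]_n :=
  V *m diag_mx (\row_i ((h i)%:C)%C) *m adjmx V.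

(* e^{i x} *)
Definition expi (x : R) : C := (cos x +i* sin x)%C.

(* e^{-iHt} by functional calculus *)
Definition evolution n (V : 'M[C]_n) (h : 'I_n -> R) (t : R) : 'M[C]_n :=
  V *m diag_mx (\row_i expi (- (h i * t))) *m adjmx V.

(* spectral projector of H onto eigenvalue E *)
Definition spec_proj n (V : 'M[C]_n) (h : 'I_n -> R) (E : R) : 'M[C]_n :=
  V *m diag_mx (\row_i ((h i == E)%:R : C)) *m adjmx V.

(* composite Hamiltonian H_X (x) 1 + 1 (x) H_Y, in diagonalised form *)
Definition comp_energy p q (hX : 'I_p -> R) (hY : 'I_q -> R) : 'I_(p * q) -> R :=
  fun k => hX (mxtens_unindex k).1 + hY (mxtens_unindex k).2.

Definition covariant n m (Vx : 'M[C]_n) (hx : 'I_n -> R) (Vy : 'M[C]_m)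
    (hy : 'I_m -> R) (f : 'M[C]_n -> 'M[C]_m) : Prop :=
  forall (sigma : 'M[C]_n) (t : R), is_state sigma ->
    f (evolution Vx hx t *m sigma *m adjmx (evolution Vx hx t)) =
    evolution Vy hy t *m f sigma *m adjmx (evolution Vy hy t).

(* D(sigma): differences E_k - E_l of eigenvalues with Pi_k sigma Pi_l <> 0 *)
Definition modes n (V : 'M[C]_n) (h : 'I_n -> R) (sigma : 'M[C]_n) : R -> Prop :=
  fun x => exists E F : R, (exists i, h i = E) /\ (exists j, h j = F) /\
    x = E - F /\ spec_proj V h E *m sigma *m spec_proj V h F != 0.

(* finite rational linear combinations *)
Definition rat_span (D : R -> Prop) : R -> Prop :=
  fun x => exists s : seq (rat * R),
    (forall p, p \in s -> D p.2) /\ x = \sum_(p <- s) ratr p.1 * p.2.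

(* C'(sigma) *)
Definition rat_modes n (V : 'M[C]_n) (h : 'I_n -> R) (sigma : 'M[C]_n) : R -> Prop :=
  rat_span (modes V h sigma).

End QDefs.

(* Main.v *)
Require Import Defs.
From HB Require Import structures.
From mathcomp Require Import all_boot all_order all_algebra.
From mathcomp Require Import sesquilinear spectral.
From mathcomp Require Import complex mxtens.
From mathcomp Require Import boolp reals trigo.
From mathcomp Require Import ring.

(* Let W be the rational span of the modes of rho. Everything is graded by the
   energy gaps modulo W: rho has degree 0, so sigma |-> L (rho (x) sigma) is a
   degree preserving channel from C to S' (x) C. Write A_(b,s) for the S'-row
   blocks of its Kraus operators, in energy eigenbases.

   If e is the degree 0 part of c, with support projection P, then e is again
   invariant, and the fixed points of X |-> P (sum_a A_a^* X A_a) P form a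
   *-algebra M, each of whose elements X satisfies X A_a P = A_a X.
   Consequently the operators G = P (sum_b A_(b,s')^* A_(b,s)) P, which compute
   the entries tr (c G) of rho', commute with M. Up to an element of the range of
   (identity - fixed point map), on which tr (c -) vanishes, G is a central
   element Z of M of the same degree k = g_s' - g_s. If k is not in W, no positive
   multiple of k is in W, because W is a rational vector space; a matrix of such a
   degree is nilpotent, and being normal it is zero. Hence the (s, s') entry of
   rho' vanishes: this is no-broadcasting of asymmetry. *)

Set Implicit Arguments.
Unset Strict Implicit.
Unset Printing Implicit Defensive.

Import Order.TTheory GRing.Theory Num.Theory.
Local Open Scope ring_scope.

(** * Positive semidefinite matrices and the trace pairing *)

Section PositiveMatrices.
Variable R : realType.
Local Notation C := (R[i]).

Lemma adjmxE m n (A : 'M[C]_(m, n)) i j : adjmx A i j = (A j i)^*.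
Proof. by rewrite !mxE. Qed.

Lemma adjmxK m n (A : 'M[C]_(m, n)) : adjmx (adjmx A) = A.
Proof. exact: trmxCK. Qed.

Lemma adjmxM m n p (A : 'M[C]_(m, n)) (B : 'M[C]_(n, p)) :
  adjmx (A *m B) = adjmx B *m adjmx A.
Proof. by rewrite /adjmx trmx_mul map_mxM. Qed.

Lemma adjmxB m n (A B : 'M[C]_(m, n)) : adjmx (A - B) = adjmx A - adjmx B.
Proof. by apply/matrixP=> i j; rewrite !mxE rmorphB. Qed.

Lemma adjmx1 n : adjmx (1%:M : 'M[C]_n) = 1%:M.
Proof. by rewrite /adjmx trmx1 map_mx1. Qed.

Lemma adjmx_sum m n (I : finType) (F : I -> 'M[C]_(m, n)) :
  adjmx (\sum_i F i) = \sum_i adjmx (F i).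
Proof.
apply/matrixP=> i j; rewrite adjmxE !summxE rmorph_sum.
by apply: eq_bigr=> k _; rewrite adjmxE.
Qed.

Lemma unitarymx_mul_adj n (V : 'M[C]_n) : V \is unitarymx -> V *m adjmx V = 1%:M.
Proof. by move/unitarymxP. Qed.

Lemma unitarymx_adj_mul n (V : 'M[C]_n) : V \is unitarymx -> adjmx V *m V = 1%:M.
Proof. by move/unitarymx_mul_adj/mulmx1C. Qed.

Lemma mxtrace_mul_adj m n (A : 'M[C]_(m, n)) :
  \tr (A *m adjmx A) = \sum_i \sum_j `|A i j| ^+ 2.
Proof.
apply: eq_bigr=> i _; rewrite mxE; apply: eq_bigr=> j _.
by rewrite adjmxE normCK.
Qed.

Lemma mxtrace_mul_adj_ge0 m n (A : 'M[C]_(m, n)) : 0 <= \tr (A *m adjmx A).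
Proof.
rewrite mxtrace_mul_adj; apply: sumr_ge0=> i _; apply: sumr_ge0=> j _.
exact: exprn_ge0.
Qed.

Lemma mxtrace_mul_adj_eq0 m n (A : 'M[C]_(m, n)) :
  \tr (A *m adjmx A) = 0 -> A = 0.
Proof.
rewrite mxtrace_mul_adj => /eqP; rewrite psumr_eq0; last first.
  by move=> i _; apply: sumr_ge0=> j _; exact: exprn_ge0.
move=> /allP h; apply/matrixP=> i j; rewrite mxE.
have /= := h i (mem_index_enum _); rewrite psumr_eq0; last first.
  by move=> k _; exact: exprn_ge0.
by move=> /allP /(_ j (mem_index_enum _)) /=; rewrite sqrf_eq0 normr_eq0 => /eqP.
Qed.

(** Nondegeneracy of the trace pairing, with the adjoint of [A - B] as test matrix. Partial traces
    are later handled by this duality. *)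
Lemma mxtrace_mul_inj m n (A B : 'M[C]_(m, n)) :
  (forall Y, \tr (A *m Y) = \tr (B *m Y)) -> A = B.
Proof.
move=> h; apply/eqP; rewrite -subr_eq0; apply/eqP/mxtrace_mul_adj_eq0.
by rewrite mulmxBl raddfB /= h subrr.
Qed.

Lemma psdmx_mul_adj m n (B : 'M[C]_(m, n)) : psdmx (B *m adjmx B).
Proof.
move=> v.
have -> : adjmx v *m (B *m adjmx B) *m v = (adjmx v *m B) *m adjmx (adjmx v *m B).
  by rewrite adjmxM adjmxK !mulmxA.
by rewrite -trace_mx11; apply: mxtrace_mul_adj_ge0.
Qed.

Lemma psdmx_conj m n (B : 'M[C]_(m, n)) (A : 'M[C]_n) :
  psdmx A -> psdmx (B *m A *m adjmx B).
Proof. by move=> hA v; have := hA (adjmx B *m v); rewrite adjmxM adjmxK !mulmxA. Qed.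

Lemma psdmx_sum n (I : finType) (F : I -> 'M[C]_n) :
  (forall i, psdmx (F i)) -> psdmx (\sum_i F i).
Proof.
move=> h v; rewrite mulmx_sumr mulmx_suml summxE; apply: sumr_ge0=> i _; exact: h.
Qed.

Lemma adjmxD m n (A B : 'M[C]_(m, n)) : adjmx (A + B) = adjmx A + adjmx B.
Proof. by apply/matrixP=> i j; rewrite !mxE rmorphD. Qed.

Lemma adjmxZ m n a (A : 'M[C]_(m, n)) : adjmx (a *: A) = a^* *: adjmx A.
Proof. by apply/matrixP=> i j; rewrite !mxE rmorphM. Qed.

Lemma adjmx_delta m n i j : adjmx (delta_mx i j : 'M[C]_(m, n)) = delta_mx j i.
Proof. by apply/matrixP=> k l; rewrite !mxE andbC rmorph_nat. Qed.

Lemma delta_form n (A : 'M[C]_n) i j :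
  (adjmx (delta_mx i 0 : 'cV[C]_n) *m A *m (delta_mx j 0 : 'cV[C]_n)) 0 0 = A i j.
Proof. by rewrite adjmx_delta -rowE -colE !mxE. Qed.

(* Polarisation on e_i + e_j and e_i + 'i e_j. *)
Lemma psdmx_hermitian n (A : 'M[C]_n) : psdmx A -> adjmx A = A.
Proof.
move=> hA; apply/matrixP=> i j; rewrite adjmxE.
have form a : 0 <= A i i + a * A i j + a^* * A j i + a^* * a * A j j.
  have := hA (delta_mx i 0 + a *: delta_mx j 0).
  rewrite adjmxD adjmxZ !(mulmxDl, mulmxDr) -?scalemxAl -?scalemxAr -?scalemxAl -?scalemxAr.
  rewrite -(delta_form A i i) -(delta_form A i j) -(delta_form A j i) -(delta_form A j j) !mxE.
  by congr (_ <= _); ring.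
have diag k : A k k \is Num.real.
  by have := ger0_real (hA (delta_mx k 0)); rewrite delta_form.
have h1 : A i j + A j i \is Num.real.
  have := ger0_real (form 1); rewrite rmorph1 !mul1r => r1.
  have := realB (realB r1 (diag i)) (diag j).
  by congr (_ \is _); ring.
have h2 : 'i * (A i j - A j i) \is Num.real.
  have := ger0_real (form 'i); rewrite conjCi !mulNr -expr2 sqrCi !mulN1r !opprK => r1.
  have := realB (realB r1 (diag i)) (diag j).
  by congr (_ \is _); ring.
move/CrealP: h1; rewrite rmorphD /= => h1.
move/CrealP: h2; rewrite rmorphM rmorphB /= conjCi mulNr -mulrN => /(mulfI (neq0Ci _)) h2.
have two_neq0 : (2 : C) != 0 by rewrite pnatr_eq0.
apply: (mulfI two_neq0).
have -> : 2 * (A j i)^* = ((A i j)^* + (A j i)^*) + - ((A i j)^* - (A j i)^*) by ring.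
by rewrite h1 h2; ring.
Qed.

Lemma psdmx_spectral n (A : 'M[C]_n) : psdmx A ->
  exists (U : 'M[C]_n) (d : 'rV[C]_n), [/\ U \is unitarymx,
    A = adjmx U *m diag_mx d *m U & forall i, 0 <= d 0 i].
Proof.
move=> hA; have hn : A \is normalmx.
  by apply/normalmxP; rewrite -/(adjmx A) psdmx_hermitian.
exists (spectralmx A), (spectral_diag A); have uU := spectral_unitarymx A.
have eA : A = adjmx (spectralmx A) *m diag_mx (spectral_diag A) *m spectralmx A.
  by move/orthomx_spectralP: hn; rewrite invmx_unitary.
split=> // i; have := hA (adjmx (spectralmx A) *m delta_mx i 0).
rewrite {2}eA adjmxM adjmxK !mulmxA -(mulmxA _ (spectralmx A)) unitarymx_mul_adj //.
rewrite mulmx1 -(mulmxA _ (spectralmx A)) unitarymx_mul_adj // mulmx1.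
by rewrite delta_form !mxE eqxx mulr1n.
Qed.

Lemma psdmx_factor n (A : 'M[C]_n) : psdmx A -> exists B : 'M[C]_n, A = B *m adjmx B.
Proof.
case/psdmx_spectral=> U [d [uU -> d0]].
exists (adjmx U *m diag_mx (\row_i sqrtC (d 0 i))).
rewrite adjmxM adjmxK !mulmxA; congr (_ *m _); rewrite -mulmxA; congr (_ *m _).
rewrite /adjmx tr_diag_mx map_diag_mx mulmx_diag; congr diag_mx.
apply/rowP=> i; rewrite !mxE /= conj_Creal; last by rewrite ger0_real ?sqrtC_ge0.
by rewrite -expr2 sqrtCK.
Qed.

(** Writing [A] as [B *m adjmx B], the trace is the squared Hilbert-Schmidt norm of [D *m B]. *)
Lemma psdmx_trace_eq0 n m (A : 'M[C]_n) (D : 'M[C]_(m, n)) : psdmx A ->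
  \tr (D *m A *m adjmx D) = 0 -> D *m A = 0.
Proof.
case/psdmx_factor=> B -> h; rewrite mulmxA.
suff -> : D *m B = 0 by rewrite mul0mx.
by apply: mxtrace_mul_adj_eq0; rewrite adjmxM !mulmxA -h !mulmxA.
Qed.

Lemma psdmx_trace_ge0 n m (A : 'M[C]_n) (D : 'M[C]_(m, n)) : psdmx A ->
  0 <= \tr (D *m A *m adjmx D).
Proof.
case/psdmx_factor=> B ->; have := mxtrace_mul_adj_ge0 (D *m B).
by rewrite adjmxM !mulmxA.
Qed.

(** [P] is the spectral projection onto the nonzero eigenvalues of [A]. The last clause holds
    because a matrix commuting with [A] preserves its eigenspaces; it later shows that [P] has
    degree zero. *)
Lemma psdmx_support n (A : 'M[C]_n) : psdmx A -> exists P : 'M[C]_n,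
  [/\ adjmx P = P, P *m P = P, P *m A = A,
      forall m (D : 'M[C]_(m, n)), D *m A = 0 -> D *m P = 0 &
      forall Z, Z *m A = A *m Z -> Z *m P = P *m Z].
Proof.
case/psdmx_spectral=> U [d [uU eA _]].
pose q : 'rV[C]_n := \row_i (d 0 i != 0)%:R.
have UK := unitarymx_mul_adj uU; have KU := unitarymx_adj_mul uU.
have qq : diag_mx q *m diag_mx q = diag_mx q.
  by rewrite mulmx_diag; congr diag_mx; apply/rowP=> i; rewrite !mxE -natrM mulnb andbb.
have qd : diag_mx q *m diag_mx d = diag_mx d.
  rewrite mulmx_diag; congr diag_mx; apply/rowP=> i; rewrite !mxE.
  by case: eqP => [->|]; rewrite ?mul0r ?mul1r.
exists (adjmx U *m diag_mx q *m U); split.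
- rewrite !adjmxM adjmxK mulmxA; congr (_ *m _ *m _).
  rewrite /adjmx tr_diag_mx map_diag_mx; congr diag_mx; apply/rowP=> i.
  by rewrite !mxE rmorph_nat.
- by rewrite !mulmxA -(mulmxA _ U) UK mulmx1 -(mulmxA (adjmx U) (diag_mx q)) qq.
- by rewrite eA !mulmxA -(mulmxA _ U) UK mulmx1 -(mulmxA (adjmx U) (diag_mx q)) qd.
- move=> m D; rewrite eA !mulmxA => h.
  have {}h : D *m adjmx U *m diag_mx d = 0.
    by rewrite -[LHS]mulmx1 -UK mulmxA h mul0mx.
  suff -> : D *m adjmx U *m diag_mx q = 0 by rewrite mul0mx.
  apply/matrixP=> i j; move/matrixP/(_ i j): h; rewrite !mul_mx_diag !mxE.
  by move/eqP; rewrite mulf_eq0 => /orP[]/eqP->; rewrite ?mul0r ?eqxx ?mulr0.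
move=> Z; rewrite eA => h.
pose Y := U *m Z *m adjmx U.
have hY : Y *m diag_mx d = diag_mx d *m Y.
  have := congr1 (fun X => U *m X *m adjmx U) h.
  by rewrite /= /Y !mulmxA UK mul1mx -!(mulmxA _ U (adjmx U)) UK !mulmx1.
have {}hY : Y *m diag_mx q = diag_mx q *m Y.
  move: (Y) hY => T hT; apply/matrixP=> i j; move/matrixP/(_ i j): hT.
  rewrite !mul_mx_diag !mul_diag_mx !mxE.
  case: (eqVneq (T i j) 0) => [->|T0]; first by rewrite !mul0r !mulr0.
  by rewrite mulrC => /(mulIf T0) ->; rewrite mulrC.
have := congr1 (fun X => adjmx U *m X *m U) hY.
by rewrite /= /Y !mulmxA KU mul1mx -!(mulmxA _ (adjmx U) U) KU mulmx1.
Qed.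

End PositiveMatrices.

(** * Gradings by energy gaps modulo a subgroup [W] of the reals *)

Section Modes.
Variable R : realType.
Local Notation C := (R[i]).
Variable W : pred R.
Hypothesis W0 : W 0.
Hypothesis WB : forall x y, W x -> W y -> W (x - y).

Lemma subgroupN x : W x -> W (- x).
Proof. by move=> Wx; rewrite -sub0r WB. Qed.

Lemma subgroupD x y : W x -> W y -> W (x + y).
Proof. by move=> Wx Wy; rewrite -[y]opprK WB ?subgroupN. Qed.

Lemma subgroup_translate x y z : W (x - y) -> W (x - z) = W (y - z).
Proof.
move=> h; apply/idP/idP=> k.
  by have := WB k h; congr (is_true (W _)); ring.
by have := subgroupD h k; congr (is_true (W _)); ring.
Qed.

Section Grading.
Variables (n : nat) (h : 'I_n -> R).

Definition has_mode (k : R) (X : 'M[C]_n) :=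
  forall i j, X i j != 0 -> W (h i - h j - k).

Definition mode_part (k : R) (X : 'M[C]_n) : 'M[C]_n :=
  \matrix_(i, j) if W (h i - h j - k) then X i j else 0.

Lemma mode_part_has_mode k X : has_mode k (mode_part k X).
Proof. by move=> i j; rewrite mxE; case: ifP => //; rewrite eqxx. Qed.

Lemma mode_part_id k X : has_mode k X -> mode_part k X = X.
Proof.
move=> hX; apply/matrixP=> i j; rewrite mxE; case: ifP => // hk.
by case: (eqVneq (X i j) 0) => // /hX; rewrite hk.
Qed.

Lemma mode_partD k X Y : mode_part k (X + Y) = mode_part k X + mode_part k Y.
Proof. by apply/matrixP=> i j; rewrite !mxE; case: ifP; rewrite ?addr0. Qed.

Lemma mode_partB k X Y : mode_part k (X - Y) = mode_part k X - mode_part k Y.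
Proof. by apply/matrixP=> i j; rewrite !mxE; case: ifP; rewrite ?subr0. Qed.

(** A nonzero [P i l] makes [h i] and [h l] congruent modulo [W], so multiplying by [P] does not
    change degrees. *)
Lemma mode_partMl k P X : has_mode 0 P -> mode_part k (P *m X) = P *m mode_part k X.
Proof.
move=> hP; apply/matrixP=> i j; rewrite !mxE.
transitivity (\sum_l if W (h i - h j - k) then P i l * X l j else 0).
  by case: ifP => // _; rewrite big1.
apply: eq_bigr=> l _; rewrite mxE.
have [->|P0] := eqVneq (P i l) 0; first by rewrite !mul0r if_same.
have := hP _ _ P0; rewrite subr0 => hil.
rewrite (@subgroup_translate (h i - h j) (h l - h j)).
  by case: ifP; rewrite ?mulr0.
by move: hil; congr (is_true (W _)); ring.
Qed.

Lemma mode_partMr k P X : has_mode 0 P -> mode_part k (X *m P) = mode_part k X *m P.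
Proof.
move=> hP; apply/matrixP=> i j; rewrite !mxE.
transitivity (\sum_l if W (h i - h j - k) then X i l * P l j else 0).
  by case: ifP => // _; rewrite big1.
apply: eq_bigr=> l _; rewrite mxE.
have [->|P0] := eqVneq (P l j) 0; first by rewrite !mulr0 if_same.
have := hP _ _ P0; rewrite subr0 => hlj.
rewrite (@subgroup_translate (h i - h j) (h i - h l)).
  by case: ifP; rewrite ?mul0r.
by move: hlj; congr (is_true (W _)); ring.
Qed.

Lemma mxtrace_mul_mode_part0 P X : has_mode 0 P ->
  \tr (P *m mode_part 0 X) = \tr (P *m X).
Proof.
move=> hP; rewrite -mode_partMl //; apply: eq_bigr=> i _.
by rewrite mxE subrr subr0 W0.
Qed.

(* The degree zero part is the pinching of X by the classes of h modulo W. *)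
Lemma psdmx_mode_part0 X : psdmx X -> psdmx (mode_part 0 X).
Proof.
move=> hX.
(* [r i] represents the class of [h i] modulo [W]; the default is never reached, as [i] itself
   passes the test. *)
pose r i := odflt i [pick l | W (h i - h l)].
have rW i : W (h i - h (r i)).
  by rewrite /r; case: pickP => //= _; rewrite subrr W0.
have rP i j : (r i == r j) = W (h i - h j - 0).
  rewrite subr0; apply/eqP/idP=> [e|hij].
    have := WB (rW i) (rW j); rewrite e.
    by congr (is_true (W _)); ring.
  rewrite /r (@eq_pick _ _ (fun l => W (h j - h l))).
    by case: pickP => //= /(_ j); rewrite subrr W0.
  by move=> l; apply: subgroup_translate.
pose Z l : 'M[C]_n := diag_mx (\row_i (r i == l)%:R).
have -> : mode_part 0 X = \sum_l Z l *m X *m adjmx (Z l).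
  apply/matrixP=> i j; rewrite summxE mxE -rP.
  have E l : (Z l *m X *m adjmx (Z l)) i j = (r i == l)%:R * X i j * (r j == l)%:R.
    rewrite /adjmx tr_diag_mx map_diag_mx mul_mx_diag mul_diag_mx !mxE /=.
    by rewrite rmorph_nat.
  rewrite (bigD1 (r i)) //= E eqxx mul1r big1 => [|l /negPf nl]; last first.
    by rewrite E eq_sym nl !mul0r.
  by rewrite addr0 eq_sym; case: eqP; rewrite ?mulr1 ?mulr0.
by apply: psdmx_sum => l; apply: psdmx_conj.
Qed.

(* A nonzero entry X i j forces a step from h j to h i by k modulo W; since k
   has infinite order modulo W, such steps order the indices, and normality
   (equality of row and column norms) kills the columns one after another. *)
Lemma normal_has_mode_eq0 k X : (forall l, ~~ W (k *+ l.+1)) -> has_mode k X ->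
  X *m adjmx X = adjmx X *m X -> X = 0.
Proof.
move=> hk hX nX.
pose above i := [set j | `[< exists l, W (h j - h i - k *+ l.+1) >]].
suff col0 N i : (#|above i| < N)%N -> forall j, X j i = 0.
  by apply/matrixP=> i j; rewrite mxE (col0 #|above j|.+1).
elim: N i => // N IH i hN j; apply/eqP; apply: contraT => Xji.
have Wji := hX _ _ Xji.
have lt_ji : above j \proper above i.
  apply/properP; split.
    apply/subsetP=> l; rewrite !inE => /asboolP[e We]; apply/asboolP; exists e.+1.
    by have := subgroupD We Wji; congr (is_true (W _)); rewrite [in RHS]mulrS; ring.
  exists j; first by rewrite inE; apply/asboolP; exists 0%N; rewrite mulr1n.
  rewrite inE; apply/asboolP=> -[e]; rewrite subrr sub0r => /subgroupN.
  by rewrite opprK; apply/negP.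
have colj := IH j (leq_trans (proper_card lt_ji) hN).
suff : X j i = 0 by move/eqP; rewrite (negPf Xji).
have : \sum_l `|X j l| ^+ 2 = 0.
  have -> : \sum_l `|X j l| ^+ 2 = (X *m adjmx X) j j.
    by rewrite mxE; apply: eq_bigr=> l _; rewrite adjmxE normCK.
  by rewrite nX mxE big1 // => l _; rewrite colj mulr0.
move/eqP; rewrite psumr_eq0; last by move=> l _; exact: exprn_ge0.
by move=> /allP /(_ i (mem_index_enum _)) /=; rewrite sqrf_eq0 normr_eq0 => /eqP.
Qed.

End Grading.

(** * Degree-preserving channels and their fixed points *)

Section Broadcast.
Variables (n m d : nat) (h : 'I_n -> R) (g : 'I_m -> R).
(** The first index numbers Kraus operators, the second their row blocks. The grading is imposed on
    sums over [b] because only these are determined by the channel: a single Kraus operator need not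
    be homogeneous. *)
Variable A : 'I_d * 'I_m -> 'M[C]_n.
Hypothesis A1 : \sum_a adjmx (A a) *m A a = 1%:M.
Hypothesis A_graded : forall s s' u v p q,
  \sum_b A (b, s) u p * (A (b, s') v q)^* != 0 ->
  W (g s - g s' + (h u - h v) - (h p - h q)).

(** Summing over both components of [a] traces out S' and leaves the channel on the catalyst; [heis]
    is its trace dual, unital by [A1]. *)
Definition schrod (X : 'M[C]_n) : 'M[C]_n := \sum_a A a *m X *m adjmx (A a).
Definition heis (X : 'M[C]_n) : 'M[C]_n := \sum_a adjmx (A a) *m X *m A a.

Lemma mxtrace_schrod X Y : \tr (schrod X *m Y) = \tr (X *m heis Y).
Proof.
rewrite mulmx_suml mulmx_sumr !raddf_sum; apply: eq_bigr=> a _ /=.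
by rewrite -!mulmxA mxtrace_mulC !mulmxA.
Qed.

Lemma heisD X Y : heis (X + Y) = heis X + heis Y.
Proof. by rewrite -big_split; apply: eq_bigr=> a _; rewrite mulmxDr mulmxDl. Qed.

Lemma heisZ x X : heis (x *: X) = x *: heis X.
Proof. by rewrite scaler_sumr; apply: eq_bigr=> a _; rewrite -scalemxAr -scalemxAl. Qed.

Lemma heis_adj X : heis (adjmx X) = adjmx (heis X).
Proof.
by rewrite adjmx_sum; apply: eq_bigr=> a _; rewrite !adjmxM adjmxK !mulmxA.
Qed.

(** The matrix of the channel in the energy basis; one selection rule for its entries serves both
    [schrod] and [heis]. *)
Let transfer u p v q : C := \sum_a A a u p * (A a v q)^*.

Lemma schrodE X u v : schrod X u v = \sum_p \sum_q X p q * transfer u p v q.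
Proof.
rewrite summxE.
transitivity (\sum_a \sum_p \sum_q X p q * (A a u p * (A a v q)^*)).
  apply: eq_bigr=> a _; rewrite mxE exchange_big; apply: eq_bigr=> q _ /=.
  rewrite mxE mulr_suml; apply: eq_bigr=> p _; rewrite adjmxE; ring.
rewrite exchange_big; apply: eq_bigr=> p _.
rewrite exchange_big; apply: eq_bigr=> q _.
by rewrite mulr_sumr.
Qed.

Lemma heisE X q p : heis X q p = \sum_v \sum_u X v u * transfer u p v q.
Proof.
rewrite summxE.
transitivity (\sum_a \sum_v \sum_u X v u * (A a u p * (A a v q)^*)).
  apply: eq_bigr=> a _; rewrite mxE exchange_big; apply: eq_bigr=> u _ /=.
  rewrite mxE mulr_suml; apply: eq_bigr=> v _; rewrite adjmxE; ring.
rewrite exchange_big; apply: eq_bigr=> p' _.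
rewrite exchange_big; apply: eq_bigr=> q' _.
by rewrite mulr_sumr.
Qed.

Lemma transfer_graded u p v q : transfer u p v q != 0 ->
  W ((h u - h v) - (h p - h q)).
Proof.
apply: contraNT => hW; rewrite /transfer.
have -> : \sum_a A a u p * (A a v q)^* = \sum_b \sum_s A (b, s) u p * (A (b, s) v q)^*.
  by rewrite pair_bigA; apply: eq_bigr=> -[].
rewrite exchange_big big1 //= => s _; apply/eqP; apply: contraNT hW => /A_graded.
by rewrite subrr add0r.
Qed.

Lemma schrod_mode_part k X : schrod (mode_part h k X) = mode_part h k (schrod X).
Proof.
apply/matrixP=> u v; rewrite [RHS]mxE !schrodE.
transitivity (\sum_p \sum_q
  if W (h u - h v - k) then X p q * transfer u p v q else 0); last first.
  by case: ifP => // _; rewrite big1 // => p _; rewrite big1.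
apply: eq_bigr=> p _; apply: eq_bigr=> q _; rewrite mxE.
have [->|t0] := eqVneq (transfer u p v q) 0; first by rewrite !mulr0 if_same.
rewrite (subgroup_translate _ (transfer_graded t0)).
by case: ifP; rewrite ?mul0r.
Qed.

Lemma heis_mode_part k X : heis (mode_part h k X) = mode_part h k (heis X).
Proof.
apply/matrixP=> q p; rewrite [RHS]mxE !heisE.
transitivity (\sum_v \sum_u
  if W (h q - h p - k) then X v u * transfer u p v q else 0); last first.
  by case: ifP => // _; rewrite big1 // => v _; rewrite big1.
apply: eq_bigr=> v _; apply: eq_bigr=> u _; rewrite mxE.
have [->|t0] := eqVneq (transfer u p v q) 0; first by rewrite !mulr0 if_same.
rewrite (@subgroup_translate (h v - h u) (h q - h p)).
  by case: ifP; rewrite ?mul0r.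
by have := subgroupN (transfer_graded t0); congr (is_true (W _)); ring.
Qed.

Section FixedPoints.
Variables (P e : 'M[C]_n).
Hypothesis e_psd : psdmx e.
Hypothesis e_fixed : schrod e = e.
Hypothesis P_adj : adjmx P = P.
Hypothesis P_idem : P *m P = P.
Hypothesis Pe : P *m e = e.
Hypothesis P_support : forall D : 'M[C]_n, D *m e = 0 -> D *m P = 0.

Let eP : e *m P = e.
Proof. by rewrite -{1}(psdmx_hermitian e_psd) -P_adj -adjmxM Pe psdmx_hermitian. Qed.

Let fix_map X := P *m heis X *m P.
(** Compressing to the support of [e] makes this invariant matrix faithful, which lets the fixed
    points form an algebra. *)
Definition fixed X := fix_map X = X.

Lemma fixed_Pl X : fixed X -> P *m X = X.
Proof. by move<-; rewrite /fix_map !mulmxA P_idem. Qed.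

Lemma fixed_Pr X : fixed X -> X *m P = X.
Proof. by move<-; rewrite /fix_map -!mulmxA P_idem. Qed.

Lemma fixed_adj X : fixed X -> fixed (adjmx X).
Proof.
by move=> fX; rewrite /fixed -[in RHS]fX /fix_map heis_adj !adjmxM P_adj mulmxA.
Qed.

(* Equality case of the Kadison-Schwarz inequality: with D a := X A_a P - A_a X,
   the sum of the D a^* D a is P heis(X^* X) P - X^* X, which e cannot see. *)
Lemma fixed_commute X : fixed X -> forall a, X *m A a *m P = A a *m X.
Proof.
move=> fX; have XP := fixed_Pr fX; have PX := fixed_Pl fX.
pose D a := X *m A a *m P - A a *m X.
have DD : \sum_a adjmx (D a) *m D a =
    fix_map (adjmx X *m X) - adjmx X *m X.
  have t1 : \sum_a P *m adjmx (A a) *m adjmx X *m X *m A a *m P =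
      fix_map (adjmx X *m X).
    rewrite /fix_map /heis mulmx_sumr mulmx_suml; apply: eq_bigr=> a _.
    by rewrite !mulmxA.
  have t2 : \sum_a P *m adjmx (A a) *m adjmx X *m A a *m X = adjmx X *m X.
    rewrite -[Y in _ = Y *m _](fixed_adj fX) /fix_map /heis mulmx_sumr !mulmx_suml.
    by apply: eq_bigr=> a _; rewrite !mulmxA -[in RHS](mulmxA _ P X) PX.
  have t3 : \sum_a adjmx X *m adjmx (A a) *m X *m A a *m P = adjmx X *m X.
    rewrite -[Y in _ = _ *m Y]fX /fix_map /heis mulmx_sumr mulmx_suml mulmx_sumr.
    apply: eq_bigr=> a _; rewrite !mulmxA.
    by rewrite (fixed_Pr (fixed_adj fX)).
  have t4 : \sum_a adjmx X *m adjmx (A a) *m A a *m X = adjmx X *m X.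
    rewrite -[Y in _ = _ *m Y]mul1mx -A1 !mulmx_suml mulmx_sumr.
    by apply: eq_bigr=> a _; rewrite !mulmxA.
  rewrite -[RHS]subr0 -[Y in _ = _ - Y](subrr (adjmx X *m X)).
  rewrite -t1 -[Y in _ = _ - Y - _]t2 -[Y in _ = _ - (Y - _)]t3 -[Y in _ = _ - (_ - Y)]t4.
  rewrite -!sumrB; apply: eq_bigr=> a _.
  by rewrite adjmxB !adjmxM P_adj mulmxBl !mulmxBr !mulmxA.
have trD a : 0 <= \tr (D a *m e *m adjmx (D a)) by apply: psdmx_trace_ge0.
have : \sum_a \tr (D a *m e *m adjmx (D a)) = 0.
  transitivity (\tr (e *m \sum_a adjmx (D a) *m D a)).
    rewrite mulmx_sumr raddf_sum; apply: eq_bigr=> a _ /=.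
    by rewrite -mulmxA mxtrace_mulC mulmxA.
  rewrite DD mulmxBr raddfB /= /fix_map !mulmxA eP mxtrace_mulC !mulmxA Pe.
  by rewrite -mxtrace_schrod e_fixed !mulmxA subrr.
move/eqP; rewrite psumr_eq0 // => /allP h0 a.
have /eqP/(psdmx_trace_eq0 e_psd)/P_support := h0 a (mem_index_enum _).
rewrite mulmxBl -!mulmxA P_idem XP !mulmxA => /eqP; rewrite subr_eq0 => /eqP.
by [].
Qed.

(** [fixed_commute] moves [Y] and then [X] to the right of each [A a]; what remains is the sum in
    [A1]. *)
Lemma fixedM X Y : fixed X -> fixed Y -> fixed (X *m Y).
Proof.
move=> fX fY; rewrite /fixed /fix_map /heis mulmx_sumr mulmx_suml.
transitivity (P *m (\sum_a adjmx (A a) *m A a) *m X *m Y); last first.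
  by rewrite A1 mulmx1 fixed_Pl.
rewrite mulmx_sumr !mulmx_suml; apply: eq_bigr=> a _.
rewrite -!mulmxA; congr (_ *m (_ *m _)).
rewrite (mulmxA Y) (fixed_commute fY) -[in LHS](fixed_Pl fY) !mulmxA.
by rewrite fixed_commute.
Qed.

Lemma fixedB X Y : fixed X -> fixed Y -> fixed (X - Y).
Proof.
rewrite /fixed /fix_map => fX fY.
by rewrite heisD -scaleN1r heisZ !scaleN1r mulmxBr mulmxBl fX fY.
Qed.

(** With [fix_mapMl], this makes the range of [T - fix_map T] stable under multiplication by fixed
    points. *)
Lemma fix_mapMr X T : fixed X -> fix_map T *m X = fix_map (T *m X).
Proof.
move=> fX; rewrite /fix_map /heis !mulmx_sumr !mulmx_suml.
apply: eq_bigr=> a _; rewrite -!mulmxA (fixed_Pl fX).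
by rewrite [X *m _]mulmxA (fixed_commute fX).
Qed.

Lemma fix_mapMl X T : fixed X -> X *m fix_map T = fix_map (X *m T).
Proof.
move=> fX; have := fix_mapMr (adjmx T) (fixed_adj fX).
move/(congr1 (@adjmx _ _ _)); rewrite /fix_map -adjmxM !heis_adj !adjmxM !adjmxK P_adj.
by rewrite !mulmxA.
Qed.

(* S is orthogonal to the range of T |-> T - fix_map T for <X, Y> = tr (e X^* Y). *)
Lemma fixed_range_eq0 S T : fixed S -> S = T - fix_map T -> S = 0.
Proof.
move=> fS eS.
have orth : \tr (e *m (adjmx S *m fix_map T)) = \tr (e *m (adjmx S *m T)).
  rewrite fix_mapMl; last exact: fixed_adj.
  by rewrite /fix_map !mulmxA eP mxtrace_mulC !mulmxA Pe -mxtrace_schrod e_fixed mulmxA.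
have : \tr (S *m e *m adjmx S) = 0.
  rewrite mxtrace_mulC mulmxA mxtrace_mulC {2}eS mulmxBr mulmxBr raddfB /= orth.
  by rewrite subrr.
by move/(psdmx_trace_eq0 e_psd)/P_support; rewrite fixed_Pr.
Qed.

(** Kernel and range of [T - fix_map T] meet only in zero by [fixed_range_eq0], so rank-nullity
    makes them complementary. *)
Lemma fixed_decomp X : exists S T, fixed S /\ X = S + (T - fix_map T).
Proof.
pose f (T : 'M[C]_n) := T - fix_map T.
have f_lin : linear f.
  move=> a T T'; rewrite /f /fix_map heisD heisZ mulmxDr mulmxDl -scalemxAr -scalemxAl.
  by rewrite scalerBr opprD addrACA.
pose fL : {linear 'M[C]_n -> 'M[C]_n} :=
  HB.pack f (GRing.isLinear.Build _ _ _ _ f f_lin).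
pose F := linfun fL.
have FE T : F T = T - fix_map T by rewrite lfunE.
have cap0 : (lker F :&: limg F = 0)%VS.
  apply/eqP; rewrite -subv0; apply/subvP=> S; rewrite memv_cap => /andP[].
  rewrite memv_ker FE subr_eq0 => /eqP kS /memv_imgP[T _]; rewrite FE memv0 => eS.
  by apply/eqP; apply: fixed_range_eq0 eS.
have : X \in (lker F + limg F)%VS.
  suff -> : (lker F + limg F = fullv)%VS by exact: memvf.
  apply/eqP; rewrite eqEdim subvf /=.
  by rewrite (dimv_disjoint_sum cap0) -(limg_ker_dim F fullv) capfv.
case/memv_addP=> S; rewrite memv_ker FE subr_eq0 => /eqP kS [Y /memv_imgP[T _ ->] ->].
by exists S, T; rewrite FE.
Qed.

Definition side_op s s' : 'M[C]_n := \sum_b adjmx (A (b, s')) *m A (b, s).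

(** [fixed_commute] for [X] crosses [A (b, s)]; its adjoint form for [adjmx X] crosses
    [adjmx (A (b, s'))]. *)
Lemma side_op_commute s s' X : fixed X ->
  X *m (P *m side_op s s' *m P) = P *m side_op s s' *m P *m X.
Proof.
move=> fX; rewrite /side_op mulmx_sumr !mulmx_suml mulmx_sumr.
apply: eq_bigr=> b _.
have AX : P *m adjmx (A (b, s')) *m X = X *m adjmx (A (b, s')).
  have := fixed_commute (fixed_adj fX) (b, s').
  by move/(congr1 (@adjmx _ _ _)); rewrite !adjmxM adjmxK P_adj mulmxA.
transitivity (X *m adjmx (A (b, s')) *m A (b, s) *m P).
  by rewrite !mulmxA (fixed_Pr fX).
rewrite -AX -!mulmxA (fixed_Pl fX); congr (_ *m (_ *m _)).
by rewrite mulmxA fixed_commute.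
Qed.

(** A nonzero entry needs an intermediate row [u] with a nonzero sum over [b]; in [A_graded] both
    rows are then [u], and their gap cancels. *)
Lemma side_op_has_mode s s' : has_mode h (g s' - g s) (side_op s s').
Proof.
move=> q p; rewrite /side_op summxE => G0.
suff [u Hu] : exists u, \sum_b A (b, s) u p * (A (b, s') u q)^* != 0.
  have := A_graded Hu; rewrite subrr addr0.
  by congr (is_true (W _)); ring.
apply/existsP; move: G0; apply: contraNT; rewrite negb_exists => /forallP all0.
rewrite (eq_bigr (fun b => \sum_u A (b, s) u p * (A (b, s') u q)^*)); last first.
  move=> b _; rewrite mxE; apply: eq_bigr=> u _; rewrite adjmxE; exact: mulrC.
by rewrite exchange_big big1 // => u _; apply/eqP; move: (all0 u); rewrite negbK.
Qed.

End FixedPoints.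

(** Torsion-freeness of the quotient of the reals by [W]: a class outside [W] has infinite order. *)
Hypothesis W_pure : forall x l, W (x *+ l.+1) -> W x.

Lemma side_op_trace_mode c s s' : psdmx c -> schrod c = c ->
  \tr (c *m side_op s s') != 0 -> W (g s - g s').
Proof.
move=> c_psd c_fixed; apply: contraNT => hW.
pose k := g s' - g s.
have hk l : ~~ W (k *+ l.+1).
  apply: contraNN hW => /W_pure/subgroupN; by rewrite opprB.
pose e := mode_part h 0 c.
have e_psd : psdmx e by apply: psdmx_mode_part0.
have e_fixed : schrod e = e by rewrite schrod_mode_part c_fixed.
have [P [P_adj P_idem Pe /(_ n) P_support P_comm]] := psdmx_support e_psd.
have hP : has_mode h 0 P.
  move=> i j Pij; rewrite subr0.
  (* [Z] selects the indices congruent to [j]. It commutes with [e], which has degree zero, hence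
     with [P]; the entry at [i], [j] of this identity forces the congruence. *)
  pose Z : 'M[C]_n := diag_mx (\row_i (W (h i - h j))%:R).
  have ZE X u v : (Z *m X) u v = (W (h u - h j))%:R * X u v.
    by rewrite mul_diag_mx !mxE.
  have EZ X u v : (X *m Z) u v = X u v * (W (h v - h j))%:R.
    by rewrite mul_mx_diag !mxE.
  have Ze : Z *m e = e *m Z.
    apply/matrixP=> u v; rewrite ZE EZ mulrC.
    have [->|e0] := eqVneq (e u v) 0; first by rewrite !mul0r.
    have := mode_part_has_mode e0; rewrite subr0 => huv.
    by rewrite (subgroup_translate _ huv).
  have := congr1 (fun X : 'M[C]_n => X i j) (P_comm Z Ze).
  rewrite /= ZE EZ subrr W0 mulr1; case: (W _) => //=.
  by rewrite mul0r => P0; rewrite -P0 eqxx in Pij.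
(* [P] is the support of the pinched [e], yet it also contains that of [c]: [1%:M - P] has degree
   zero, so its traces against [c] and [e] agree. *)
have Pc : P *m c = c.
  suff : (1%:M - P) *m c = 0.
    by rewrite mulmxBl mul1mx => /eqP; rewrite subr_eq0 => /eqP.
  apply: psdmx_trace_eq0 => //.
  have Q_idem : (1%:M - P) *m (1%:M - P) = 1%:M - P.
    by rewrite mulmxBl mul1mx mulmxBr mulmx1 P_idem subrr subr0.
  rewrite adjmxB adjmx1 P_adj mxtrace_mulC mulmxA Q_idem.
  rewrite -(mxtrace_mul_mode_part0 (h := h)) -/e; last first.
    move=> i j; rewrite !mxE; have [->|ij] := eqVneq i j.
      by rewrite subrr subr0 W0.
    by rewrite sub0r oppr_eq0 => /hP.
  by rewrite mulmxBl mul1mx Pe subrr raddf0.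
have cP : c *m P = c.
  by rewrite -{1}(psdmx_hermitian c_psd) -P_adj -adjmxM Pc psdmx_hermitian.
pose Y := P *m side_op s s' *m P.
have hY : mode_part h k Y = Y.
  by rewrite mode_partMr // mode_partMl // (mode_part_id (@side_op_has_mode s s')).
have [S [T [fS eY]]] := fixed_decomp e_psd e_fixed P_adj P_idem Pe P_support Y.
have part_fix X : mode_part h k (P *m heis X *m P) = P *m heis (mode_part h k X) *m P.
  by rewrite mode_partMr // mode_partMl // heis_mode_part.
(* Taking degree [k] parts commutes with the compressed dual map, so the decomposition of [Y] passes
   to them. *)
pose S' := mode_part h k S; pose T' := mode_part h k T.
have {}fS : fixed P S' by rewrite /fixed -part_fix fS.
have {}eY : Y = S' + (T' - P *m heis T' *m P).
  by rewrite -hY eY mode_partD mode_partB part_fix.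
have S'0 : S' = 0.
  apply: (normal_has_mode_eq0 hk (mode_part_has_mode (X := S))).
  set X := adjmx S'; have fX : fixed P X by apply: fixed_adj.
  have comm : X *m Y = Y *m X by apply: (side_op_commute e_psd e_fixed).
  (* Since [X] commutes with [Y], the commutator of [S'] and [X] equals [X *m T' - T' *m X] minus
     the image of that matrix under the compressed dual map. Being also fixed, it vanishes, so [S']
     is normal. *)
  apply/eqP; rewrite -subr_eq0; apply/eqP.
  apply: (fixed_range_eq0 (T := X *m T' - T' *m X) e_psd e_fixed P_adj P_idem Pe P_support).
    by apply: fixedB; apply: (fixedM e_psd e_fixed).
  have XF := fix_mapMl e_psd e_fixed P_adj P_idem Pe P_support T' fX.
  have FX := fix_mapMr e_psd e_fixed P_adj P_idem Pe P_support T' fX.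
  have -> : P *m heis (X *m T' - T' *m X) *m P =
      X *m (P *m heis T' *m P) - P *m heis T' *m P *m X.
    by rewrite heisD -scaleN1r heisZ scaleN1r mulmxBr mulmxBl XF FX.
  move: comm; rewrite eY mulmxDl mulmxDr mulmxBl mulmxBr => comm.
  apply/eqP; rewrite subr_eq -[X in X == _](addrK (T' *m X - P *m heis T' *m P *m X)) -comm.
  by rewrite -addrA addrC !opprB addrACA [X in _ == X + _]addrACA (addrC (- (T' *m X))).
have -> : \tr (c *m side_op s s') = \tr (c *m Y).
  by rewrite /Y !mulmxA cP [RHS]mxtrace_mulC mulmxA Pc.
(* What is left of [Y] is [T'] minus its image, on which the trace against the invariant [c] is
   zero. *)
rewrite eY S'0 add0r mulmxBr raddfB /= !mulmxA cP (mxtrace_mulC _ P) !mulmxA Pc.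
by rewrite -mxtrace_schrod c_fixed subrr.
Qed.

End Broadcast.
End Modes.

(** * Tensor products, partial traces and Kraus operators *)

Section TensorAndChannels.
Variable R : realType.
Local Notation C := (R[i]).

Lemma big_mxtens (V : nmodType) m n (F : 'I_(m * n) -> V) :
  \sum_i F i = \sum_i \sum_j F (mxtens_index (i, j)).
Proof.
rewrite pair_bigA /= (reindex (@mxtens_index m n)) /=.
  by apply: eq_bigr=> -[].
by exists (@mxtens_unindex m n) => k _; rewrite ?mxtens_indexK ?mxtens_unindexK.
Qed.

Lemma adjmx_tens m n p q (A : 'M[C]_(m, n)) (B : 'M[C]_(p, q)) :
  adjmx (A *t B) = adjmx A *t adjmx B.
Proof. by rewrite /adjmx trmx_tens map_mxT. Qed.

Lemma tensmx1 m n : (1%:M : 'M[C]_m) *t (1%:M : 'M[C]_n) = 1%:M.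
Proof.
apply/matrixP=> i j; case: (mxtens_indexP i) => i1 i2; case: (mxtens_indexP j) => j1 j2.
rewrite tensmxE !mxE -natrM mulnb (can_eq (@mxtens_indexK _ _)).
by rewrite xpair_eqE.
Qed.

Lemma tensmx_unitary m n (A : 'M[C]_m) (B : 'M[C]_n) :
  A \is unitarymx -> B \is unitarymx -> A *t B \is unitarymx.
Proof.
move=> uA uB; apply/unitarymxP; rewrite -/(adjmx _) adjmx_tens tensmx_mul.
by rewrite !unitarymx_mul_adj // tensmx1.
Qed.

Lemma mxtrace_tens m n (A : 'M[C]_m) (B : 'M[C]_n) : \tr (A *t B) = \tr A * \tr B.
Proof.
rewrite /mxtrace big_mxtens mulr_suml; apply: eq_bigr=> i _.
by rewrite mulr_sumr; apply: eq_bigr=> j _; rewrite tensmxE.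
Qed.

Lemma mxtrace_ptr_first p q (X : 'M[C]_(p * q)) Y :
  \tr (ptr_first X *m Y) = \tr (X *m (1%:M *t Y)).
Proof.
rewrite /mxtrace big_mxtens exchange_big; apply: eq_bigr=> c _ /=.
rewrite mxE (eq_bigr _ (fun c' _ => congr1 ( *%R^~ (Y c' c)) (mxE _ _ c c'))) /=.
under eq_bigr => c' _ do rewrite mulr_suml.
rewrite exchange_big; apply: eq_bigr=> s _ /=.
rewrite mxE big_mxtens (bigD1 s) //= [X in _ + X]big1 ?addr0; last first.
  by move=> s' /negPf ns; apply: big1=> c' _; rewrite tensmxE mxE ns mul0r mulr0.
by apply: eq_bigr=> c' _; rewrite tensmxE mxE eqxx mul1r.
Qed.

Lemma mxtrace_ptr_second p q (X : 'M[C]_(p * q)) Y :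
  \tr (ptr_second X *m Y) = \tr (X *m (Y *t 1%:M)).
Proof.
rewrite /mxtrace big_mxtens; apply: eq_bigr=> s _ /=.
rewrite mxE (eq_bigr _ (fun s' _ => congr1 ( *%R^~ (Y s' s)) (mxE _ _ s s'))) /=.
under eq_bigr => s' _ do rewrite mulr_suml.
rewrite exchange_big; apply: eq_bigr=> c _ /=.
rewrite mxE big_mxtens; apply: eq_bigr=> s' _.
rewrite (bigD1 c) //= [X in _ + X]big1 ?addr0; last first.
  by move=> c' /negPf nc; rewrite tensmxE mxE nc !mulr0.
by rewrite tensmxE mxE eqxx mulr1.
Qed.

Lemma ptr_first_conj p q (S : 'M[C]_p) (T : 'M[C]_q) X : adjmx S *m S = 1%:M ->
  ptr_first ((S *t T) *m X *m adjmx (S *t T)) = T *m ptr_first X *m adjmx T.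
Proof.
move=> hS; apply: mxtrace_mul_inj => Y.
rewrite mxtrace_ptr_first -!mulmxA mxtrace_mulC -!mulmxA adjmx_tens !tensmx_mul mul1mx.
by rewrite hS -mxtrace_ptr_first [RHS]mxtrace_mulC !mulmxA.
Qed.

Lemma ptr_second_conj p q (S : 'M[C]_p) (T : 'M[C]_q) X : adjmx T *m T = 1%:M ->
  ptr_second ((S *t T) *m X *m adjmx (S *t T)) = S *m ptr_second X *m adjmx S.
Proof.
move=> hT; apply: mxtrace_mul_inj => Y.
rewrite mxtrace_ptr_second -!mulmxA mxtrace_mulC -!mulmxA adjmx_tens !tensmx_mul mul1mx.
by rewrite hT -mxtrace_ptr_second [RHS]mxtrace_mulC !mulmxA.
Qed.

(** This is [N] with the first tensor factor of its output contracted against the basis vector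
    [s]. *)
Definition row_block m n p (N : 'M[C]_(m * n, p)) (s : 'I_m) : 'M[C]_(n, p) :=
  \matrix_(u, j) N (mxtens_index (s, u)) j.

Lemma row_block_conj m n p (N N' : 'M[C]_(m * n, p)) X s s' u v :
  (N *m X *m adjmx N') (mxtens_index (s, u)) (mxtens_index (s', v)) =
  (row_block N s *m X *m adjmx (row_block N' s')) u v.
Proof.
rewrite !mxE; apply: eq_bigr=> j _; rewrite !mxE; congr (_ * _).
by apply: eq_bigr=> k _; rewrite !mxE.
Qed.

Lemma ptr_first_row_block m n p (N : 'M[C]_(m * n, p)) X :
  ptr_first (N *m X *m adjmx N) =
  \sum_s row_block N s *m X *m adjmx (row_block N s).
Proof.
apply/matrixP=> u v; rewrite summxE mxE; apply: eq_bigr=> s _.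
exact: row_block_conj.
Qed.

Lemma ptr_second_row_block m n p (N : 'M[C]_(m * n, p)) X s s' :
  ptr_second (N *m X *m adjmx N) s s' =
  \tr (X *m (adjmx (row_block N s') *m row_block N s)).
Proof.
rewrite mulmxA mxtrace_mulC mulmxA mxE; apply: eq_bigr=> u _.
exact: row_block_conj.
Qed.

Lemma adjmx_mul_row_block m n p (N : 'M[C]_(m * n, p)) :
  \sum_s adjmx (row_block N s) *m row_block N s = adjmx N *m N.
Proof.
apply/matrixP=> i j; rewrite summxE mxE big_mxtens; apply: eq_bigr=> s _.
by rewrite mxE; apply: eq_bigr=> u _; rewrite !mxE.
Qed.

(** Choi's argument: the positive matrix is factored as [B *m adjmx B], and each column of [B],
    reshaped, is a Kraus operator. *)
Lemma kraus_decomposition n m (f : {linear 'M[C]_n -> 'M[C]_m}) :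
  psdmx (\matrix_(i, j) f (delta_mx (mxtens_unindex i).1 (mxtens_unindex j).1)
      (mxtens_unindex i).2 (mxtens_unindex j).2 : 'M[C]_(n * m)) ->
  exists N : 'I_(n * m) -> 'M[C]_(m, n),
    forall X, f X = \sum_b N b *m X *m adjmx (N b).
Proof.
case/psdmx_factor=> B hB.
exists (fun b => \matrix_(u, p) B (mxtens_index (p, u)) b) => X.
rewrite {1}[X]matrix_sum_delta linear_sum; apply/matrixP=> u v.
rewrite !summxE.
transitivity (\sum_p \sum_q \sum_b X p q *
    (B (mxtens_index (p, u)) b * (B (mxtens_index (q, v)) b)^*)).
  apply: eq_bigr=> p _; rewrite linear_sum summxE; apply: eq_bigr=> q _.
  rewrite linearZ mxE -mulr_sumr; congr (_ * _).
  move/matrixP/(_ (mxtens_index (p, u)) (mxtens_index (q, v))): hB.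
  rewrite mxE !mxtens_indexK /= => ->; rewrite mxE.
  by apply: eq_bigr=> b _; rewrite adjmxE.
under eq_bigr => p _ do rewrite exchange_big.
rewrite exchange_big; apply: eq_bigr=> b _ /=.
rewrite mxE exchange_big; apply: eq_bigr=> q _ /=.
rewrite mxE mulr_suml; apply: eq_bigr=> p _; rewrite !mxE /=; ring.
Qed.

(** States span all matrices: rescaling reaches every [B *m adjmx B], and polarisation the matrix
    units. This extends covariance, assumed on states, to all matrices. *)
Lemma linear_state_eq0 n m (f : {linear 'M[C]_n -> 'M[C]_m}) :
  (forall X, is_state X -> f X = 0) -> forall X, f X = 0.
Proof.
move=> hf.
have f_psd k (B : 'M[C]_(n, k)) : f (B *m adjmx B) = 0.
  have [/mxtrace_mul_adj_eq0 ->|t0] := eqVneq (\tr (B *m adjmx B)) 0.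
    by rewrite mul0mx linear0.
  have tp : 0 < \tr (B *m adjmx B) by rewrite lt_def t0 mxtrace_mul_adj_ge0.
  have st : is_state ((\tr (B *m adjmx B))^-1 *: (B *m adjmx B)).
    split; last by rewrite mxtraceZ mulVf.
    move=> v; rewrite -scalemxAr -scalemxAl mxE; apply: mulr_ge0.
      by rewrite invr_ge0 ltW.
    exact: psdmx_mul_adj.
  have := hf _ st; rewrite linearZ /= => /eqP.
  by rewrite scaler_eq0 invr_eq0 (negPf t0) => /eqP.
have f_delta i j : f (delta_mx i j) = 0.
  pose e k : 'cV[C]_n := delta_mx k 0.
  have E k l : e k *m adjmx (e l) = delta_mx k l.
    by rewrite adjmx_delta mul_delta_mx.
  have Q a : f (delta_mx i i) + a^* *: f (delta_mx i j) + a *: f (delta_mx j i)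
      + (a * a^*) *: f (delta_mx j j) = 0.
    rewrite -(f_psd _ (e i + a *: e j)) adjmxD adjmxZ mulmxDl !mulmxDr.
    rewrite -!scalemxAr -!scalemxAl !E scalerA !linearD !linearZ /=.
    by rewrite addrA (mulrC a).
  have D k : f (delta_mx k k) = 0 by rewrite -E.
  (* [a = 1] makes the values at the two off-diagonal units opposite, and [a = 'i] makes them
     equal. *)
  have := Q 1; rewrite rmorph1 !D scaler0 addr0 add0r !scale1r => Q1.
  have := Q 'i; rewrite !D scaler0 addr0 add0r conjCi scaleNr => /eqP.
  rewrite addrC subr_eq0 => /eqP/(scalerI (neq0Ci _)) Q2.
  move: Q1; rewrite Q2 -mulr2n => /eqP; rewrite -scaler_nat scaler_eq0.
  by rewrite pnatr_eq0 => /eqP.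
move=> X; rewrite [X]matrix_sum_delta linear_sum big1 // => i _.
rewrite linear_sum big1 // => j _; by rewrite linearZ /= f_delta scaler0.
Qed.

End TensorAndChannels.

(** * Covariance in energy eigenbases, modes and rational spans *)

Section Covariance.
Variable R : realType.
Local Notation C := (R[i]).

Lemma expi_mul_conj (x y : R) : expi x * (expi y)^* = expi (x - y).
Proof.
rewrite /expi cosB sinB; apply/eqP; rewrite eq_complex /=.
by apply/andP; split; apply/eqP; ring.
Qed.

Lemma expi_freq_inj (x y : R) : (forall t, expi (x * t) = expi (y * t)) -> x = y.
Proof.
move=> hxy; apply/eqP; rewrite -subr_eq0; apply: contraT => xy0.
(* At this time the phase of frequency [x - y] is [expi pi], that is -1, although it should be 1. *)
have := hxy (pi / (x - y)).
move/(congr1 (fun z => z * (expi (y * (pi / (x - y))))^*)).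
rewrite !expi_mul_conj subrr -mulrBl mulrC divfK // => /eqP.
rewrite /expi eq_complex /= cospi cos0 => /andP[+ _].
by rewrite (lt_eqF (lt_trans (ltrN10 _) ltr01)).
Qed.

Lemma diag_delta_diag n (d d' : 'rV[C]_n) i j :
  diag_mx d *m delta_mx i j *m adjmx (diag_mx d') =
  (d 0 i * (d' 0 j)^*) *: delta_mx i j.
Proof.
rewrite /adjmx tr_diag_mx map_diag_mx mul_mx_diag mul_diag_mx.
apply/matrixP=> u v; rewrite !mxE /=.
by case: (eqVneq u i) => [->|_]; case: (eqVneq v j) => [->|_]; rewrite /= ?mulr0 ?mul0r ?mulr1.
Qed.

Definition in_basis n m (V : 'M[C]_n) (V' : 'M[C]_m) (f : 'M[C]_n -> 'M[C]_m) X :=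
  adjmx V' *m f (V *m X *m adjmx V) *m V'.

(** Evolution multiplies the input unit and the output entry by phases whose frequencies are their
    energy gaps; a nonzero entry cancels, and the phases agree at all times. *)
Lemma covariant_in_basis n m (V : 'M[C]_n) (h : 'I_n -> R) (V' : 'M[C]_m)
    (h' : 'I_m -> R) (f : {linear 'M[C]_n -> 'M[C]_m}) i j u v :
  V \is unitarymx -> V' \is unitarymx -> covariant V h V' h' f ->
  in_basis V V' f (delta_mx i j) u v != 0 -> h i - h j = h' u - h' v.
Proof.
move=> uV uV' cov f0.
have VK := unitarymx_adj_mul uV; have VK' := unitarymx_adj_mul uV'.
have cov_all X t : f (evolution V h t *m X *m adjmx (evolution V h t)) =
    evolution V' h' t *m f X *m adjmx (evolution V' h' t).
  pose k X := f (evolution V h t *m X *m adjmx (evolution V h t)) -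
    evolution V' h' t *m f X *m adjmx (evolution V' h' t).
  have k_lin : linear k.
    move=> a Y Z; rewrite /k mulmxDr mulmxDl -scalemxAr -scalemxAl !(linearP f).
    by rewrite mulmxDr mulmxDl -scalemxAr -scalemxAl scalerBr opprD addrACA.
  pose kL : {linear 'M[C]_n -> 'M[C]_m} :=
    HB.pack k (GRing.isLinear.Build _ _ _ _ k k_lin).
  have kL0 Y : is_state Y -> kL Y = 0.
    by move=> stY; rewrite /= /k cov // subrr.
  by have /= /eqP := linear_state_eq0 kL0 X; rewrite /k subr_eq0 => /eqP.
suff freq t : expi (- (h i - h j) * t) = expi (- (h' u - h' v) * t).
  by apply: oppr_inj; apply: expi_freq_inj.
pose D := diag_mx (\row_i expi (- (h i * t))).
pose D' := diag_mx (\row_i expi (- (h' i * t))).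
set y := in_basis V V' f (delta_mx i j).
have : (expi (- (h i * t)) * (expi (- (h j * t)))^*) *: y = D' *m y *m adjmx D'.
  transitivity (in_basis V V' f (D *m delta_mx i j *m adjmx D)).
    rewrite diag_delta_diag !mxE /in_basis -scalemxAr -scalemxAl linearZ /=.
    by rewrite -scalemxAr -scalemxAl.
  rewrite /in_basis.
  have -> : V *m (D *m delta_mx i j *m adjmx D) *m adjmx V =
    evolution V h t *m (V *m delta_mx i j *m adjmx V) *m adjmx (evolution V h t).
    by rewrite /evolution !adjmxM adjmxK !mulmxA -!(mulmxA _ (adjmx V) V) VK !mulmx1.
  rewrite cov_all /evolution !adjmxM adjmxK -/D' !mulmxA VK' mul1mx.
  by rewrite -!(mulmxA _ (adjmx V') V') VK' !mulmx1 /y /in_basis ?mulmxA.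
move: f0; rewrite -/y; move: {y}(y) => y f0 /matrixP/(_ u v).
rewrite /adjmx tr_diag_mx map_diag_mx mul_mx_diag mul_diag_mx.
rewrite !mxE /= [RHS]mulrAC => /(mulIf f0).
rewrite !expi_mul_conj => e; move: e; congr (expi _ = expi _); ring.
Qed.

Lemma in_basis_neq0 n m (V : 'M[C]_n) (V' : 'M[C]_m)
    (f : {linear 'M[C]_n -> 'M[C]_m}) X u v :
  in_basis V V' f X u v != 0 ->
  exists i j, X i j != 0 /\ in_basis V V' f (delta_mx i j) u v != 0.
Proof.
have -> : in_basis V V' f X u v =
    \sum_ij X ij.1 ij.2 * in_basis V V' f (delta_mx ij.1 ij.2) u v.
  rewrite -(pair_bigA _ (fun i j => X i j * in_basis V V' f (delta_mx i j) u v)) /=.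
  rewrite {1}[X]matrix_sum_delta /in_basis mulmx_sumr mulmx_suml linear_sum.
  rewrite mulmx_sumr mulmx_suml summxE; apply: eq_bigr=> i _.
  rewrite mulmx_sumr mulmx_suml linear_sum mulmx_sumr mulmx_suml summxE.
  apply: eq_bigr=> j _; rewrite -scalemxAr -scalemxAl linearZ /=.
  by rewrite -scalemxAr -scalemxAl mxE.
move=> nz.
have /existsP[[i j] /=] : [exists ij,
    X ij.1 ij.2 * in_basis V V' f (delta_mx ij.1 ij.2) u v != 0].
  move: nz; apply: contraNT; rewrite negb_exists => /forallP all0.
  by rewrite big1 // => ij _; apply/eqP; have := all0 ij; rewrite negbK.
by rewrite mulf_eq0 negb_or => /andP[? ?]; exists i, j.
Qed.

Lemma mul_delta_adj n m n' m' (B : 'M[C]_(m, n)) (B' : 'M[C]_(m', n')) p q u v :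
  (B *m delta_mx p q *m adjmx B') u v = B u p * (B' v q)^*.
Proof.
rewrite -(mul_delta_mx (0 : 'I_1)) mulmxA -colE -mulmxA -rowE mxE big_ord1.
by rewrite !mxE.
Qed.

(** In the eigenbasis the spectral projectors are diagonal indicators, so a block between two
    levels, degenerate or not, can be tested entry by entry. *)
Lemma modesP n (V : 'M[C]_n) h (X : 'M[C]_n) x : V \is unitarymx ->
  modes V h X x <-> exists i j, x = h i - h j /\ (adjmx V *m X *m V) i j != 0.
Proof.
move=> uV; have VK := unitarymx_adj_mul uV.
pose Z E : 'M[C]_n := diag_mx (\row_i (h i == E)%:R).
have entry E F i j : (adjmx V *m (spec_proj V h E *m X *m spec_proj V h F) *m V) i j
    = (h i == E)%:R * (adjmx V *m X *m V) i j * (h j == F)%:R.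
  transitivity ((Z E *m (adjmx V *m X *m V) *m Z F) i j).
    congr (fun_of_matrix _ i j); rewrite /spec_proj !mulmxA VK mul1mx.
    by rewrite -(mulmxA _ (adjmx V) V) VK mulmx1.
  by rewrite mul_mx_diag mul_diag_mx !mxE.
split=> [[E [F [_ [_ [-> nz]]]]]|[i [j [-> nz]]]].
  have [[i j]] : exists ij : 'I_n * 'I_n,
      (adjmx V *m (spec_proj V h E *m X *m spec_proj V h F) *m V) ij.1 ij.2 != 0.
    apply/existsP; move: nz; apply: contraNT; rewrite negb_exists => /forallP all0.
    set Y := spec_proj V h E *m X *m spec_proj V h F.
    have Y0 : adjmx V *m Y *m V = 0.
      apply/matrixP=> i j; rewrite [RHS]mxE; apply/eqP.
      by have := all0 (i, j); rewrite negbK.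
    move: {all0}Y Y0 => Y Y0; have := congr1 (fun T => V *m T *m adjmx V) Y0.
    rewrite /= mulmx0 mul0mx !mulmxA unitarymx_mul_adj // mul1mx.
    by rewrite -mulmxA unitarymx_mul_adj // mulmx1 => ->.
  rewrite /= entry; case: (eqVneq (h i) E) => [<-|_]; last by rewrite !mul0r eqxx.
  case: (eqVneq (h j) F) => [<-|_]; last by rewrite !mulr0 eqxx.
  by rewrite mul1r mulr1 => nz'; exists i, j.
exists (h i), (h j); split; first by exists i.
split; first by exists j.
split=> //; apply: contraNN nz => /eqP e0.
by have := entry (h i) (h j) i j; rewrite e0 mulmx0 mul0mx mxE !eqxx mul1r mulr1 => <-.
Qed.

Lemma rat_span_mem (D : R -> Prop) x : D x -> rat_span D x.
Proof.
move=> Dx; exists [:: (1, x)]; split; last by rewrite big_seq1 rmorph1 mul1r.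
by move=> p; rewrite inE => /eqP->.
Qed.

Lemma rat_span0 (D : R -> Prop) : rat_span D 0.
Proof. by exists [::]; split=> //; rewrite big_nil. Qed.

Lemma rat_spanD (D : R -> Prop) x y : rat_span D x -> rat_span D y -> rat_span D (x + y).
Proof.
case=> s [hs ->] [s' [hs' ->]]; exists (s ++ s'); split; last by rewrite big_cat.
by move=> p; rewrite mem_cat => /orP[/hs|/hs'].
Qed.

Lemma rat_spanZ (D : R -> Prop) a x : rat_span D x -> rat_span D (ratr a * x).
Proof.
case=> s [hs ->]; exists [seq (a * p.1, p.2) | p <- s]; split.
  by move=> _ /mapP[p /hs ? ->].
by rewrite big_map mulr_sumr; apply: eq_bigr=> p _; rewrite rmorphM mulrA.
Qed.

Lemma rat_spanB (D : R -> Prop) x y : rat_span D x -> rat_span D y -> rat_span D (x - y).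
Proof.
move=> hx hy; rewrite -[- y]mulN1r.
have -> : -1 = ratr (-1) :> R by rewrite rmorphN rmorph1.
by apply: rat_spanD => //; apply: rat_spanZ.
Qed.

(** Division by [l.+1] is a rational scaling. This supplies [W_pure]. *)
Lemma rat_span_pure (D : R -> Prop) x l : rat_span D (x *+ l.+1) -> rat_span D x.
Proof.
move/(rat_spanZ (l.+1%:R^-1)); rewrite -[x *+ _]mulr_natl fmorphV rmorph_nat mulKf //.
by rewrite pnatr_eq0.
Qed.

Lemma rat_span_sub (D D' : R -> Prop) x :
  (forall y, D y -> rat_span D' y) -> rat_span D x -> rat_span D' x.
Proof.
move=> hD [s [hs ->]]; elim: s hs => [|p s IH] hs.
  by rewrite big_nil; apply: rat_span0.
rewrite big_cons; apply: rat_spanD.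
  by apply/rat_spanZ/hD/hs; rewrite mem_head.
by apply: IH => q qs; apply: hs; rewrite inE qs orbT.
Qed.


(* The Choi matrix of sigma |-> L (rho (x) sigma) is (id (x) L) applied to rho
   together with the unnormalised maximally entangled vector. *)
Lemma channel_tens_kraus nS nC m (L : 'M[C]_(nS * nC) -> 'M[C]_m) (rho : 'M[C]_nS) :
  is_channel L -> psdmx rho ->
  exists N : 'I_(nC * m) -> 'M[C]_(m, nC),
    forall X, L (rho *t X) = \sum_b N b *m X *m adjmx (N b).
Proof.
case=> Llin Lcp _ rho_psd.
pose f X := L (rho *t X).
have f_lin : linear f.
  move=> a X Y; rewrite /f -Llin; congr (L _).
  by apply/matrixP=> i j; rewrite !mxE; ring.
pose fL : {linear 'M[C]_nC -> 'M[C]_m} :=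
  HB.pack f (GRing.isLinear.Build _ _ _ _ f f_lin).
have [|N hN] := @kraus_decomposition _ _ _ fL; last by exists N.
(* [J] sends the basis vector [s] to the sum over [p] of p (x) s (x) p, so conjugating [rho] by it
   gives the matrix with blocks [rho *t delta_mx p q]. *)
pose J : 'M[C]_(nC * (nS * nC), nS) := \matrix_(i, s)
  (((mxtens_unindex i).1 == (mxtens_unindex (mxtens_unindex i).2).2)%:R *
  ((mxtens_unindex (mxtens_unindex i).2).1 == s)%:R).
have := Lcp nC _ (psdmx_conj J rho_psd); congr psdmx.
apply/matrixP=> i j; rewrite !mxE /= /f; congr (L _ _ _).
apply/matrixP=> u v; case: (mxtens_indexP u) => s p; case: (mxtens_indexP v) => s' q.
rewrite tensmxE mxE mxE (bigD1 s') //= big1 ?addr0 => [|t /negPf ts]; last first.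
  by rewrite !mxE !mxtens_indexK /= (eq_sym s') ts mulr0 rmorph0 mulr0.
rewrite mxE (bigD1 s) //= big1 ?addr0 => [|t /negPf ts]; last first.
  by rewrite !mxE !mxtens_indexK /= (eq_sym s) ts mulr0 mul0r.
rewrite !mxE !mxtens_indexK /= !eqxx !mulr1 rmorph_nat (eq_sym p) (eq_sym q).
by rewrite mulrC mulrA -natrM mulnb andbC mulrC.
Qed.

End Covariance.

Theorem theorem3 (R : realType) (nS nS' nC : nat)
  (VS : 'M[R[i]]_nS) (hS : 'I_nS -> R)
  (VS' : 'M[R[i]]_nS') (hS' : 'I_nS' -> R)
  (VC : 'M[R[i]]_nC) (hC : 'I_nC -> R)
  (uS : VS \is unitarymx) (uS' : VS' \is unitarymx) (uC : VC \is unitarymx)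
  (rho : 'M[R[i]]_nS) (c : 'M[R[i]]_nC)
  (L : 'M[R[i]]_(nS * nC) -> 'M[R[i]]_(nS' * nC)) :
  is_state rho -> is_state c -> is_channel L ->
  covariant (VS *t VC) (comp_energy hS hC) (VS' *t VC) (comp_energy hS' hC) L ->
  ptr_first (L (rho *t c)) = c ->
  forall x : R,
    rat_modes VS' hS' (ptr_second (L (rho *t c))) x -> rat_modes VS hS rho x.
Proof.
move=> [rho_psd rho_tr] [c_psd _] L_channel L_cov c_fixed x.
(* It suffices to treat one generator: a gap of S' at a nonzero entry of the output in the
   eigenbasis. *)
apply: rat_span_sub => {}x /(modesP _ _ _ uS') [s [s' [-> nz]]].
have [Llin _ Ltr] := L_channel.
pose LL : {linear 'M[R[i]]_(nS * nC) -> 'M[R[i]]_(nS' * nC)} :=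
  HB.pack L (GRing.isLinear.Build _ _ _ _ L Llin).
have LL_cov : covariant (VS *t VC) (comp_energy hS hC) (VS' *t VC)
  (comp_energy hS' hC) LL := L_cov.
have [N hN] := channel_tens_kraus L_channel rho_psd.
pose V := VS *t VC; pose V' := VS' *t VC.
have uV : V \is unitarymx by apply: tensmx_unitary.
have uV' : V' \is unitarymx by apply: tensmx_unitary.
(* Kraus operators in the energy eigenbases; [A] cuts them into row blocks over S'. *)
pose N0 b := adjmx V' *m N b *m VC.
pose A (bs : 'I_(nC * (nS' * nC)) * 'I_nS') := row_block (N0 bs.1) bs.2.
pose c0 := adjmx VC *m c *m VC; pose rho0 := adjmx VS *m rho *m VS.
pose W y : bool := `[< rat_modes VS hS rho y >].
have sumA (F : 'I_(nC * (nS' * nC)) -> 'I_nS' -> 'M[R[i]]_nC) :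
    \sum_a F a.1 a.2 = \sum_b \sum_s F b s by rewrite pair_bigA.
have N0E X : \sum_b N0 b *m X *m adjmx (N0 b) = in_basis V V' L (rho0 *t X).
  rewrite /in_basis; have -> : V *m (rho0 *t X) *m adjmx V = rho *t (VC *m X *m adjmx VC).
    rewrite adjmx_tens !tensmx_mul /rho0 !mulmxA unitarymx_mul_adj // mul1mx.
    by rewrite -(mulmxA rho) unitarymx_mul_adj // mulmx1.
  rewrite hN mulmx_sumr mulmx_suml; apply: eq_bigr=> b _.
  by rewrite /N0 !adjmxM adjmxK !mulmxA.
have N0c : \sum_b N0 b *m c0 *m adjmx (N0 b) = adjmx V' *m L (rho *t c) *m V'.
  rewrite N0E /in_basis; congr (_ *m L _ *m _).
  rewrite adjmx_tens !tensmx_mul /rho0 /c0 !mulmxA !unitarymx_mul_adj // !mul1mx.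
  by rewrite -(mulmxA rho) -(mulmxA c) !unitarymx_mul_adj // !mulmx1.
suff : W (hS' s - hS' s') by move/asboolP.
(* Covariance traces a nonzero output entry on [rho0 *t delta_mx p q] back to a nonzero entry of
   [rho0], whose gap is the combination shown and is thus a mode of [rho]. *)
have graded t t' u v p q : \sum_b A (b, t) u p * (A (b, t') v q)^* != 0 ->
    W (hS' t - hS' t' + (hC u - hC v) - (hC p - hC q)).
  have -> : \sum_b A (b, t) u p * (A (b, t') v q)^* =
      in_basis V V' L (rho0 *t delta_mx p q) (mxtens_index (t, u)) (mxtens_index (t', v)).
    rewrite -N0E summxE; apply: eq_bigr=> b _; rewrite row_block_conj.
    by rewrite mul_delta_adj.
  case/(in_basis_neq0 (f := LL))=> i [j [+ /(covariant_in_basis uV uV' LL_cov)]].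
  case: (mxtens_indexP i) => r p'; case: (mxtens_indexP j) => r' q'.
  rewrite tensmxE [delta_mx _ _ _ _]mxE /comp_energy !mxtens_indexK /=.
  have [->|] := eqVneq p' p; last by rewrite mulr0 eqxx.
  have [->|] := eqVneq q' q; last by rewrite mulr0 eqxx.
  rewrite mulr1 => rho0_neq0 energy; apply/asboolP/rat_span_mem/modesP => //.
  exists r, r'; split=> //.
  apply/eqP; rewrite -subr_eq0; move/eqP: energy; rewrite -subr_eq0 -oppr_eq0.
  by congr (_ == 0); ring.
apply: (@side_op_trace_mode _ W _ _ _ _ _ hC hS' A _ graded _ c0).
- exact/asboolP/rat_span0.
- by move=> y z /asboolP hy /asboolP hz; apply/asboolP/rat_spanB.
(* Trace preservation of the channel, tested against an arbitrary [X]; the factor [\tr rho] is 1. *)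
- rewrite (sumA (fun b s => adjmx (row_block (N0 b) s) *m row_block (N0 b) s)).
  under eq_bigr => b _ do rewrite adjmx_mul_row_block.
  apply: mxtrace_mul_inj => X; rewrite mul1mx mulmx_suml raddf_sum /=.
  transitivity (\tr (\sum_b N0 b *m X *m adjmx (N0 b))).
    rewrite raddf_sum; apply: eq_bigr=> b _ /=.
    by rewrite [RHS]mxtrace_mulC -mulmxA.
  rewrite N0E /in_basis mxtrace_mulC mulmxA unitarymx_mul_adj // mul1mx Ltr.
  rewrite mxtrace_mulC mulmxA unitarymx_adj_mul // mul1mx mxtrace_tens.
  by rewrite /rho0 mxtrace_mulC mulmxA unitarymx_mul_adj // mul1mx rho_tr mul1r.
- by move=> y l /asboolP/rat_span_pure ?; apply/asboolP.
- have := psdmx_conj (adjmx VC) c_psd; by rewrite adjmxK.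
- rewrite /schrod (sumA (fun b s => row_block (N0 b) s *m c0 *m adjmx (row_block (N0 b) s))).
  under eq_bigr => b _ do rewrite -ptr_first_row_block.
  transitivity (ptr_first (\sum_b N0 b *m c0 *m adjmx (N0 b))).
    apply/matrixP=> u v; rewrite summxE mxE.
    under eq_bigr => b _ do rewrite mxE.
    by rewrite exchange_big; apply: eq_bigr=> t _; rewrite summxE.
  rewrite N0c /V' -{2}(adjmxK (VS' *t VC)) (adjmx_tens VS') ptr_first_conj ?adjmxK ?c_fixed //.
  exact: unitarymx_mul_adj.
(* The trace against [side_op] is the output entry chosen at the start, which is nonzero. *)
- have <- : (adjmx VS' *m ptr_second (L (rho *t c)) *m VS') s s' =
      \tr (c0 *m side_op A s s'); last exact: nz.
  rewrite -{2}(adjmxK VS') -(ptr_second_conj (adjmx VS') (T := adjmx VC)); last first.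
    by rewrite adjmxK unitarymx_mul_adj.
  rewrite -adjmx_tens adjmxK -N0c mxE /side_op mulmx_sumr raddf_sum /=.
  under eq_bigr => t _ do rewrite summxE.
  rewrite exchange_big; apply: eq_bigr=> b _ /=.
  by rewrite -ptr_second_row_block mxE.
Qed.
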